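(* Let $1\leq k<d$ be integers and let $\theta\in(0,1)$. If $X\subseteq\mathbb{R}^d$ is bounded, then for $\gamma_{d,k}$-almost all $V\in G(d,k)$, \[ \overline{\dim}_{\mathrm{B}} P_V(X)\ \geq\ \overline{\dim}_{\mathrm{B}} X-\max\big\{0,\ \overline{\dim}_{\mathrm{A}}^{\theta}X-k,\ (\dim_{\mathrm{A}}X-k)(1-\theta)\big\}. \]
   Context: For non-empty bounded $E\subseteq\mathbb{R}^d$ and $r>0$, $N_r(E)$ is the minimal number of sets of diameter $r$ needed to cover $E$. The upper box dimension is $\overline{\dim}_{\mathrm{B}}E=\limsup_{r\to0}\frac{\log N_r(E)}{-\log r}$. The Assouad dimension $\dim_{\mathrm{A}}X$ is the infimum of $\alpha>0$ for which there is $C>0$ with $N_r(B(x,R)\cap X)\leq C(R/r)^\alpha$ for all $0<r<R$ and $x\in X$. The upper Assouad spectrum $\overline{\dim}_{\mathrm{A}}^{\theta}X$ (for $\theta\in(0,1)$) is the infimum of $\alpha$ for which there is $C>0$ with $N_r(B(x,R)\cap X)\leq C(R/r)^\alpha$ for all $0<r\leq R^{1/\theta}<R<1$ and all $x\in X$. $G(d,k)$ is the Grassmannian of $k$-dimensional linear subspaces of $\mathbb{R}^d$, equipped with the rotation-invariant Borel probability measure $\gamma_{d,k}$; $P_V:\mathbb{R}^d\to V$ is orthogonal projection onto $V$ (with $V$ identified with $\mathbb{R}^k$). *)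

(* Defs.v *)
From HB Require Import structures.
From mathcomp Require Import all_boot all_order all_algebra.
From mathcomp Require Import all_classical all_reals all_analysis.
Set Implicit Arguments. Unset Strict Implicit. Unset Printing Implicit Defensive.
Import Order.TTheory GRing.Theory Num.Theory.
Import numFieldNormedType.Exports.
Local Open Scope classical_set_scope.
Local Open Scope ring_scope.

Section Defs.
Variable R : realType.

Definition edist (d : nat) (x y : 'rV[R]_d) : R :=
  Num.sqrt (\sum_(i < d) (x ord0 i - y ord0 i) ^+ 2).

(* Euclidean diameter (in \bar R; the empty set has diameter -oo). *)
Definition ediam (d : nat) (E : set 'rV[R]_d) : \bar R :=
  ereal_sup [set (edist p.1 p.2)%:E | p in E `*` E].

Definition eball (d : nat) (x : 'rV[R]_d) (r : R) : set 'rV[R]_d :=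
  [set y | edist x y < r].

Definition ebounded (d : nat) (X : set 'rV[R]_d) : Prop :=
  exists M : R, forall x, X x -> edist 0 x <= M.

Definition coverable (d : nat) (E : set 'rV[R]_d) (r : R) (n : nat) : Prop :=
  exists F : nat -> set 'rV[R]_d,
    (forall i, (i < n)%N -> (ediam (F i) <= r%:E)%E) /\
    E `<=` \bigcup_(i in [set i : nat | (i < n)%N]) F i.

(* N_r(E): minimal number of sets of diameter r covering E (+oo if none). *)
Definition covnum (d : nat) (E : set 'rV[R]_d) (r : R) : \bar R :=
  ereal_inf [set (n%:R)%:E | n in [set n : nat | coverable E r n]].

Definition box_ratio (d : nat) (E : set 'rV[R]_d) (r : R) : \bar R :=
  match covnum E r with
  | EFin N => (ln N / - ln r)%:E
  | +oo%E => +oo%E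
  | -oo%E => -oo%E
  end.

Definition upper_box_dim (d : nat) (E : set 'rV[R]_d) : \bar R :=
  limf_esup (box_ratio E) (0%R)^'+.

Definition assouad_dim (d : nat) (X : set 'rV[R]_d) : \bar R :=
  ereal_inf [set a%:E | a in [set a : R | 0 < a /\
    exists C : R, 0 < C /\
      forall (r Rr : R) (x : 'rV[R]_d), 0 < r -> r < Rr -> X x ->
        (covnum (eball x Rr `&` X) r <= (C * (Rr / r) `^ a)%:E)%E]].

Definition upper_assouad_spectrum (d : nat) (theta : R) (X : set 'rV[R]_d)
  : \bar R :=
  ereal_inf [set a%:E | a in [set a : R | 0 < a /\
    exists C : R, 0 < C /\
      forall (r Rr : R) (x : 'rV[R]_d),
        0 < r -> r <= Rr `^ theta^-1 -> Rr `^ theta^-1 < Rr -> Rr < 1 ->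
        X x ->
        (covnum (eball x Rr `&` X) r <= (C * (Rr / r) `^ a)%:E)%E]].

(* G(d,k), each V represented by its orthogonal projection matrix P_V
   (symmetric, idempotent, rank k). *)
Definition grass (d k : nat) : set 'M[R]_d :=
  [set P | P^T = P /\ P *m P = P /\ \rank P = k].

Definition projV (d : nat) (P : 'M[R]_d) (X : set 'rV[R]_d) : set 'rV[R]_d :=
  [set x *m P | x in X].

Definition BorelMx (d : nat) := g_sigma_algebraType (@open 'M[R]_d).

(* gamma_{d,k}: a Borel probability measure concentrated on G(d,k),
   invariant under rotations (V |-> U V, i.e. P |-> U P U^T). *)
Definition rotation_invariant_grass_measure (d k : nat)
  (gamma : probability (BorelMx d) R) : Prop :=
  gamma (@grass d k : set (BorelMx d)) = 1%E /\
  forall U : 'M[R]_d, U *m U^T = 1%:M ->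
    forall A : set (BorelMx d), measurable A ->
      gamma ((fun P : BorelMx d => (U *m P *m U^T : BorelMx d)) @^-1` A)
      = gamma A.

End Defs.

(* Main.v *)
Require Import Defs.
From HB Require Import structures.
From mathcomp Require Import all_boot all_order all_algebra.
From mathcomp Require Import all_classical all_reals all_analysis.
From mathcomp Require Import measurable_realfun ring lra zify.
Set Implicit Arguments.
Unset Strict Implicit.
Unset Printing Implicit Defensive.
Import Order.TTheory GRing.Theory Num.Theory.
Import numFieldNormedType.Exports.
Local Open Scope classical_set_scope.
Local Open Scope ring_scope.

(**
A second moment argument.  Let [E] be a maximal [rho]-separated subset of [X],
with [M] points.  If the projection of [X] to [V] is covered by [N] sets of
diameter [rho], then by Cauchy-Schwarz at least [M ^ 2 / N] pairs of points of
[E] have projections within [rho] of each other.  The [gamma]-measure of the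
planes bringing the projections of [x] and [y] within [rho] is at most a
constant times [(rho / |x - y|) ^ k].  Grouping the pairs into dyadic shells
[|x - y| ~ R] and bounding the number of points of [E] in a ball of radius [R]
by the spectrum when [rho ^ theta <= R] and by the Assouad dimension when
[R < rho ^ theta], the expected number of such pairs is at most
[M * rho ^ (- m - e)], where [m] is the maximum in the theorem and [e > 0] is
arbitrary.  By Markov's inequality [N >= M * rho ^ (m + 2 e)] outside a set of
planes of measure [O(rho ^ e)], and such sets are available at arbitrarily small
scales.

The estimate for a single pair uses only the invariance of [gamma]: the measure
depends on [|x - y|] alone, so it can be averaged over the directions of the
points of the grid [{0, ..., n} ^ d], and an [O(1)]-neighbourhood of a
[(d - k)]-plane contains [O(n ^ (d - k))] of these points.
*)

(* Without this notation, [edist] is the extended distance of MathComp-Analysis. *)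
Local Notation edist := Defs.edist.

(** * Grid points close to a plane *)

(** Subtraction is truncated, so the two bounds together say [|p - q| <= D], and a multiple of
    [D + 1] that small is zero. This lets a residue encode a coordinate known up to [D]. *)
Lemma eq_of_eq_mod (D p q : nat) :
  p = q %[mod D.+1] -> (p - q <= D)%N -> (q - p <= D)%N -> p = q.
Proof.
wlog pq : p q / (p <= q)%N => [H|] e H1 H2.
  by case: (leqP p q) => [/H|/ltnW/H] E; [apply: E|apply/esym/E].
move/esym/eqP: e; rewrite eqn_mod_dvd // => dv.
apply/eqP; rewrite eqn_leq pq /= -subn_eq0.
by case: (q - p)%N dv H2 => // m /dvdn_leq Dm mD; have := Dm isT; lia.
Qed.

Section MaximalMinor.
Variables (F : realFieldType) (d k : nat).

(** Off column [i] the submatrix is still the identity, so expanding along row [i] leaves one term,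
    with cofactor 1. *)
Lemma det_replace_col (Q : 'M[F]_(k, d)) (f g : 'I_k -> 'I_d) (i : 'I_k) :
  colsub f Q = 1%:M -> (forall b, b != i -> g b = f b) ->
  \det (colsub g Q) = Q i (g i).
Proof.
move=> fQ gf.
have entE a b : b != i -> colsub g Q a b = (a == b)%:R.
  by move=> bi; move/matrixP/(_ a b): fQ; rewrite !mxE gf.
rewrite (expand_det_row _ i) (bigD1 i) //= big1 ?addr0 => [|b bi]; last first.
  by rewrite entE // eq_sym (negbTE bi) mul0r.
rewrite /cofactor.
have -> : row' i (col' i (colsub g Q)) = 1%:M.
  apply/matrixP => a b; rewrite 2!mxE entE; last by rewrite eq_sym neq_lift.
  by rewrite mxE (inj_eq (@lift_inj _ i)).
by rewrite det1 mulr1 mxE -signr_odd oddD addbb expr0 mulr1.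
Qed.

(* Cramer's rule applied to a maximal [k]-minor of a basis of the row space. *)
Lemma bounded_coordinates (P : 'M[F]_d) :
  P *m P = P -> \rank P = k ->
  exists (f : 'I_k -> 'I_d) (Q : 'M[F]_(k, d)),
    [/\ injective f, colsub f Q = 1%:M, forall i j, `|Q i j| <= 1 & Q *m P = Q].
Proof.
move=> PP rP.
have [B [Bfree BP]] : exists B : 'M[F]_(k, d), row_free B /\ B *m P = B.
  case: _ / rP.
  exists (row_base P); split; first exact: row_base_free.
  have /submxP [D ->] : (row_base P <= P)%MS by rewrite eq_row_base.
  by rewrite -mulmxA PP.
have [f0 f0B] : exists f0 : {ffun 'I_k -> 'I_d}, \det (colsub f0 B) != 0.
  have Bfull : row_full B^T by rewrite /row_full mxrank_tr; move: Bfree.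
  exists (fullrankfun Bfull).
  have := fullrowsub_unit Bfull.
  rewrite -unitmx_tr unitmxE unitfE.
  suff -> : (rowsub (fullrankfun Bfull) B^T)^T = colsub (fullrankfun Bfull) B by [].
  by apply/matrixP => a b; rewrite !mxE.
(* [f] selects the columns of the [k]-minor of largest absolute value; normalising this block to the
   identity gives [Q]. *)
have [f _ fmax] := @Order.TotalTheory.arg_maxP _ _ _ f0 xpredT
  (fun g : {ffun 'I_k -> 'I_d} => `|\det (colsub g B)|) isT.
have fdet0 : 0 < `|\det (colsub f B)|.
  by apply: lt_le_trans (fmax f0 isT); rewrite normr_gt0.
have fB : colsub f B \in unitmx by rewrite unitmxE unitfE -normr_gt0.
pose Q := invmx (colsub f B) *m B.
have subQ g : colsub g Q = invmx (colsub f B) *m colsub g B.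
  by apply/matrixP => a b; rewrite !mxE; apply: eq_bigr => c _; rewrite !mxE.
have fQ : colsub f Q = 1%:M by rewrite subQ mulVmx.
exists f, Q; split => //.
- move=> a b ab; apply/eqP; move/matrixP/(_ a b): (fQ).
  move/matrixP/(_ a a): fQ; rewrite !mxE ab eqxx => ->.
  by case: (a == b) => // /eqP; rewrite oner_eq0.
(* Putting column [j] in place of the [i]-th chosen one shows that [Q i j] is a quotient of a minor
   of [B] by the maximal one. *)
- move=> i j; pose g : {ffun 'I_k -> 'I_d} := [ffun b => if b == i then j else f b].
  have gi : g i = j by rewrite ffunE eqxx.
  have := @det_replace_col Q f g i fQ.
  rewrite gi => <-; last by move=> b bi; rewrite ffunE (negbTE bi).
  rewrite subQ det_mulmx det_inv normrM normfV mulrC ler_pdivrMr // mul1r.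
  exact: fmax.
- by rewrite -mulmxA BP.
Qed.

End MaximalMinor.

Definition sqn (F : realFieldType) (d : nat) (z : 'rV[F]_d) : F :=
  \sum_(i < d) z ord0 i ^+ 2.

Section SquaredNorm.
Variables (F : realFieldType) (d : nat).
Implicit Types (z u : 'rV[F]_d).

Lemma sqnE z : sqn z = (z *m z^T) ord0 ord0.
Proof. by rewrite mxE; apply: eq_bigr => i _; rewrite mxE expr2. Qed.

Lemma sqn_ge0 z : 0 <= sqn z.
Proof. by apply: sumr_ge0 => i _; apply: sqr_ge0. Qed.

Lemma sqn_eq0 z : (sqn z == 0) = (z == 0).
Proof.
apply/eqP/eqP => [|->]; last by rewrite /sqn big1 // => i _; rewrite mxE expr0n.
move=> /psumr_eq0P H; apply/rowP => i; rewrite mxE.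
by apply/eqP; rewrite -sqrf_eq0; apply/eqP/H => // j _; apply: sqr_ge0.
Qed.

Lemma sqn_gt0 z : (0 < sqn z) = (z != 0).
Proof. by rewrite lt_def sqn_eq0 sqn_ge0 andbT. Qed.

Lemma sqnZ c z : sqn (c *: z) = c ^+ 2 * sqn z.
Proof. by rewrite /sqn mulr_sumr; apply: eq_bigr => i _; rewrite mxE exprMn. Qed.

Lemma sqnN z : sqn (- z) = sqn z.
Proof. by rewrite /sqn; apply: eq_bigr => i _; rewrite mxE sqrrN. Qed.

Lemma sqn_orth z (U : 'M[F]_d) : U *m U^T = 1%:M -> sqn (z *m U) = sqn z.
Proof. by move=> UU; rewrite !sqnE trmx_mul mulmxA -(mulmxA z) UU mulmx1. Qed.

Lemma sqnD_le z u : sqn (z + u) <= 2 * sqn z + 2 * sqn u.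
Proof.
rewrite /sqn !mulr_sumr -big_split /=; apply: ler_sum => i _; rewrite mxE.
have := sqr_ge0 (z ord0 i - u ord0 i); nra.
Qed.

Lemma coord_le_sqn z i : z ord0 i ^+ 2 <= sqn z.
Proof. by rewrite /sqn (bigD1 i) //= lerDl sumr_ge0 // => j _; apply: sqr_ge0. Qed.

(** For [c >= 1] one has [c <= c ^ 2], so [c] serves as a crude bound for its own square root. *)
Lemma coord_le_of_sqn z i c : 1 <= c -> sqn z <= c -> `|z ord0 i| <= c.
Proof.
move=> c1 zc; have := le_trans (coord_le_sqn z i) zc.
have c0 : 0 <= c by apply: le_trans c1.
rewrite -real_normK ?num_real // => zc2.
rewrite -(@ler_pXn2r _ 2) ?nnegrE ?normr_ge0 //.
by apply: le_trans zc2 _; rewrite expr2 ler_peMr.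
Qed.

Definition gridv (n : nat) (w : {ffun 'I_d -> 'I_n.+1}) : 'rV[F]_d :=
  \row_i (nat_of_ord (w i))%:R.

Lemma sqn_gridv n (w : {ffun 'I_d -> 'I_n.+1}) : sqn (gridv w) <= d%:R * n%:R ^+ 2.
Proof.
rewrite /sqn; apply: le_trans (_ : \sum_(i < d) n%:R ^+ 2 <= _).
  apply: ler_sum => i _; rewrite mxE ler_sqr ?nnegrE ?ler0n // ler_nat.
  by rewrite -ltnS.
by rewrite sumr_const card_ord -[leLHS]mulr_natl.
Qed.

Variable k : nat.

(* Off the range of [f] the coordinates of [w] are free; once they are fixed,
   the remaining [k] coordinates are confined to intervals of length [2 * d ^ 2]. *)
Lemma card_small_projection (P : 'M[F]_d) (n : nat) :
  P^T = P -> P *m P = P -> \rank P = k ->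
  (#|[set w : {ffun 'I_d -> 'I_n.+1} | (sqn (gridv w *m P) <= d%:R)%R]%SET|
   <= n.+1 ^ (d - k) * (2 * d ^ 2).+1 ^ k)%N.
Proof.
move=> Ps PP rP; set D := (2 * d ^ 2)%N.
have [f [Q [finj fQ Qle QP]]] := bounded_coordinates PP rP.
pose off := {i : 'I_d | i \notin codom f}.
(* The free coordinates are kept in full, the [k] confined ones only modulo [D + 1]; the count
   reduces to injectivity of [h]. *)
pose h (w : {ffun 'I_d -> 'I_n.+1}) : {ffun off -> 'I_n.+1} * {ffun 'I_k -> 'I_D.+1} :=
  ([ffun i => w (val i)], [ffun a => inord (w (f a) %% D.+1)]).
set A := [set w | _]%SET.
have hinj : {in A &, injective h}.
  move=> w w'; rewrite !inE => wA w'A [/ffunP h1 /ffunP h2].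
  pose u : 'rV[F]_d := gridv w - gridv w'.
  have uoff j : j \notin codom f -> u ord0 j = 0.
    by move=> jf; have := h1 (exist _ j jf); rewrite !ffunE !mxE => ->; rewrite subrr.
  (* Since [u] vanishes off the range of [f], where [Q] is the identity, [Q] reads off the confined
     coordinates of [u]; and [Q *m P = Q] lets [u] be replaced by its projection. *)
  have uf a : u ord0 (f a) = \sum_j Q a j * (u *m P) ord0 j.
    transitivity (\sum_j Q a j * u ord0 j).
      rewrite (bigD1 (f a)) //= big1 => [|j jfa].
        by move/matrixP/(_ a a): fQ; rewrite !mxE eqxx => ->; rewrite mul1r addr0.
      case: (boolP (j \in codom f)) => [/codomP [b jb]|/uoff ->]; last by rewrite mulr0.
      move/matrixP/(_ a b): fQ; rewrite !mxE -jb => ->.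
      by case: eqP => [ab|_]; rewrite ?mul0r //; rewrite jb ab eqxx in jfa.
    have : Q *m u^T = Q *m (u *m P)^T by rewrite trmx_mul Ps mulmxA QP.
    move/matrixP/(_ a ord0); rewrite !mxE => E.
    transitivity (\sum_j Q a j * u^T j ord0); first by apply: eq_bigr => j _; rewrite [u^T _ _]mxE.
    by rewrite E; apply: eq_bigr => j _; rewrite [X in _ * X]mxE.
  (* There are [d] terms, each at most [2 * d]: entries of [Q] are bounded by 1 and each of the two
     projections has coordinates at most [d]. *)
  have ufle a : `|u ord0 (f a)| <= D%:R.
    have d1 : 1 <= d%:R :> F by rewrite ler1n; case: (d) (f a) => [[]|].
    rewrite uf; apply: le_trans (ler_norm_sum _ _ _) _.
    apply: le_trans (_ : \sum_(j < d) (2 * d%:R) <= _).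
      apply: ler_sum => j _; rewrite normrM -[leRHS]mul1r; apply: ler_pM => //.
      rewrite mulmxBl mxE [X in _ + X]mxE; apply: le_trans (ler_normB _ _) _.
      by rewrite mulr_natl mulr2n; apply: lerD; apply: coord_le_of_sqn.
    by rewrite sumr_const card_ord -[leLHS]mulr_natr /D natrM natrX; lra.
  apply/ffunP => j; case: (boolP (j \in codom f)) => [/codomP [a ->]|jf]; last first.
    by have := h1 (exist _ j jf); rewrite !ffunE.
  have /(congr1 val) := h2 a; rewrite !ffunE /= !inordK ?ltn_pmod // => Emod.
  have := ufle a; rewrite !mxE => H; apply/val_inj => /=.
  have {}H : (w (f a) - w' (f a) <= D)%N /\ (w' (f a) - w (f a) <= D)%N.
    case: (leqP (w (f a)) (w' (f a))) => ww.
      have -> : (w (f a) - w' (f a) = 0)%N by lia.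
      by split => //; move: H; rewrite distrC -natrB // normr_nat ler_nat.
    have -> : (w' (f a) - w (f a) = 0)%N by lia.
    by split => //; move: H; rewrite -natrB ?normr_nat ?ler_nat // ltnW.
  by case: H => H1 H2; exact: eq_of_eq_mod Emod H1 H2.
rewrite -(card_in_imset hinj); apply: leq_trans (max_card _) _.
rewrite card_prod !card_ffun !card_ord.
rewrite card_sig; apply: leq_mul => //; apply: leq_pexp2l => //.
have kE : #|codom f| = k by rewrite card_codom // card_ord.
set c := #|_|; suff : (k + c = d)%N by lia.
by rewrite -kE -[RHS]card_ord; exact: cardC.
Qed.

End SquaredNorm.

(** * Measure of the planes almost orthogonal to a vector *)

Section CountingIntegrals.
Context (R : realType) (dsp : measure_display) (T : measurableType dsp).
Variables (mu : {measure set T -> \bar R}) (I : finType) (B : I -> set T).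
Hypothesis mB : forall i, measurable (B i).

Definition hits (x : T) : R := \sum_i \1_(B i) x.

Lemma measurable_hits : measurable_fun setT hits.
Proof. by apply: measurable_sum => i; apply: measurable_indic. Qed.

Lemma integral_hits (D : set T) : measurable D ->
  (\int[mu]_(x in D) (hits x)%:E = \sum_i mu (B i `&` D))%E.
Proof.
move=> mD; under eq_integral do rewrite /hits -sumEFin.
rewrite ge0_integral_sum //=.
- by apply: eq_bigr => i _; rewrite integral_indic.
- by move=> i; apply/measurable_EFinP; apply: measurable_indic.
Qed.

Lemma hits_ge0 x : 0 <= hits x.
Proof. by apply: sumr_ge0 => i _; rewrite indicE. Qed.

Lemma sum_measure_le_hits (D : set T) (c : R) : measurable D ->
  (forall x, D x -> hits x <= c) -> 0 <= c ->
  (\sum_i mu (B i `&` D) <= c%:E * mu D)%E.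
Proof.
move=> mD Dc c0; rewrite -integral_hits // -integral_cst //.
apply: ge0_le_integral => //.
- by move=> x _; rewrite lee_fin hits_ge0.
- by apply/measurable_EFinP; apply: measurable_funTS; exact: measurable_hits.
Qed.

Lemma measurable_hits_ge (c : R) : measurable [set x | c <= hits x].
Proof.
have -> : [set x | c <= hits x] = setT `&` hits @^-1` `[c, +oo[.
  by rewrite setTI; apply/seteqP; split => x /=; rewrite in_itv /= andbT.
exact: measurable_hits.
Qed.

Lemma hits_markov (c : R) : 0 <= c ->
  (c%:E * mu [set x | c <= hits x]%R <= \sum_i mu (B i))%E.
Proof.
move=> c0; have mD := measurable_hits_ge c.
rewrite -integral_cst //.
apply: (@le_trans _ _ (\int[mu]_(x in [set x | (c <= hits x)%R]) (hits x)%:E)%E).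
  apply: ge0_le_integral => //.
  by apply/measurable_EFinP; apply: measurable_funTS; exact: measurable_hits.
rewrite integral_hits //; apply: lee_sum => i _.
by apply: le_measure; rewrite ?inE //; apply: measurableI.
Qed.

End CountingIntegrals.

Section Grassmannian.
Variables (R : realType) (d k : nat).
Implicit Types (P U : 'M[R]_d) (z : 'rV[R]_d).

(** Write [P = A *m B] with [A] of full column rank and [B] of full row rank; cancelling in
    [A B A B = A B] gives [B *m A = 1]. The rank condition thus becomes a closed condition on the
    trace, which makes [grass] measurable. *)
Lemma trace_idempotent P : P *m P = P -> \tr P = (\rank P)%:R.
Proof.
have /row_freeP := row_base_free P; have /row_fullP := col_base_full P.
move: (mulmx_base P); move: (\rank P) (col_base P) (row_base P) => r A B <-.
move=> [C CA] [D BD] PP; rewrite mxtrace_mulC.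
suff -> : B *m A = 1%:M by rewrite mxtrace_scalar.
have : C *m (A *m B *m (A *m B)) *m D = C *m (A *m B) *m D by rewrite PP.
by rewrite !mulmxA CA !mul1mx -!mulmxA BD mulmx1.
Qed.

Lemma continuous_entry (i j : 'I_d) : continuous (fun P : 'M[R]_d => P i j).
Proof. exact: coord_continuous. Qed.

Lemma continuous_sumr (T : topologicalType) (J : Type) (r : seq J) (F : J -> T -> R) :
  (forall i, continuous (F i)) -> continuous (fun x => \sum_(i <- r) F i x).
Proof.
by move=> cF; apply: (@continuous_big R J +%R 0 xpredT) => //; exact: add_continuous.
Qed.

Lemma closed_measurable_mx (A : set 'M[R]_d) : closed A -> measurable (A : set (BorelMx R d)).
Proof.
move=> cA; rewrite -[A]setCK; apply: measurableC.
by apply: sub_sigma_algebra; rewrite openC.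
Qed.

Definition small_projection z (c : R) : set (BorelMx R d) :=
  [set P | sqn (z *m P) <= c].

Lemma measurable_small_projection z (c : R) : measurable (small_projection z c).
Proof.
apply: closed_measurable_mx.
have cf : continuous (fun P : 'M[R]_d => sqn (z *m P)).
  apply: continuous_sumr => j P.
  apply: (@continuous_comp _ _ _ (fun P => (z *m P) ord0 j) (fun x => x ^+ 2));
    last exact: exprn_continuous.
  have -> : (fun P : 'M[R]_d => (z *m P) ord0 j) = (fun P => \sum_i z ord0 i * P i j).
    by apply/funext => Q; rewrite mxE.
  apply: continuous_sumr => i {}P; apply: continuousM; first exact: cst_continuous.
  exact: continuous_entry.
exact: (continuous_closedP _).1 cf _ (@closed_le R c).
Qed.

Lemma measurable_grass : measurable (@grass R d k : set (BorelMx R d)).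
Proof.
apply: closed_measurable_mx.
have clo0 (f : 'M[R]_d -> R) : continuous f -> closed [set P | f P = 0].
  by move=> cf; exact: (continuous_closedP _).1 cf _ (@closed_eq R 0).
have -> : @grass R d k =
  (\bigcap_(p in [set: 'I_d * 'I_d]) [set P : 'M[R]_d | P p.2 p.1 - P p.1 p.2 = 0]) `&`
  ((\bigcap_(p in [set: 'I_d * 'I_d]) [set P : 'M[R]_d | (P *m P) p.1 p.2 - P p.1 p.2 = 0]) `&`
  [set P : 'M[R]_d | \tr P - k%:R = 0]).
  apply/seteqP; split => P /=.
    move=> [Ps [PP rP]]; split; [|split].
    - by move=> [i j] _ /=; rewrite -{1}Ps mxE subrr.
    - by move=> [i j] _ /=; rewrite PP subrr.
    - by rewrite trace_idempotent // rP subrr.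
  move=> [Ps [PP rP]].
  have PPE : P *m P = P.
    by apply/matrixP => i j; apply/eqP; rewrite -subr_eq0; apply/eqP/(PP (i, j)).
  split; [|split] => //.
    by apply/matrixP => i j; rewrite mxE; apply/eqP; rewrite -subr_eq0; apply/eqP/(Ps (i, j)).
  apply/eqP; rewrite -(@eqr_nat R) -trace_idempotent //.
  by rewrite -subr_eq0; apply/eqP.
have csub (f g : 'M[R]_d -> R) : continuous f -> continuous g -> continuous (fun P => f P - g P).
  by move=> cf cg P; apply: continuousB; [exact: cf|exact: cg].
apply: closedI; [|apply: closedI].
- by apply: closed_bigI => p _; apply: clo0; apply: csub; apply: continuous_entry.
- apply: closed_bigI => p _; apply: clo0; apply: csub; last exact: continuous_entry.
  have -> : (fun P => (P *m P) p.1 p.2) = (fun P : 'M[R]_d => \sum_i P p.1 i * P i p.2).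
    by apply/funext => Q; rewrite mxE.
  by apply: continuous_sumr => i P; apply: continuousM; exact: continuous_entry.
- apply: clo0; apply: csub; last by move=> P; exact: cst_continuous.
  by apply: continuous_sumr => i P; exact: continuous_entry.
Qed.

(** When [z] and [z'] differ, [U] is the Householder reflection in the hyperplane orthogonal to
    [z - z']. *)
Lemma reflection_between z z' : sqn z = sqn z' ->
  exists U, [/\ U^T = U, U *m U = 1%:M & z *m U = z'].
Proof.
move=> zz; have [<-|nzz] := eqVneq z z'.
  by exists 1%:M; rewrite trmx1 !mulmx1.
have [v vE] : exists v, v = z - z' by exists (z - z').
pose b := 2 / sqn v.
have v0 : sqn v != 0 by rewrite sqn_eq0 vE subr_eq0.
have vv : v *m v^T = (sqn v)%:M by rewrite [LHS]mx11_scalar -sqnE.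
have zv : z *m v^T = (sqn v / 2)%:M.
  rewrite [LHS]mx11_scalar; congr (_%:M); rewrite mxE.
  apply: (@mulIf _ 2) => //; rewrite divfK //.
  (* Equal norms give [2 <z, v> = |v|^2]: the added difference is zero and turns the identity into
     one that holds coordinatewise. *)
  have -> : sqn v = sqn v + (sqn z - sqn z') by rewrite zz subrr addr0.
  rewrite /sqn -sumrB -big_split /= mulr_suml; apply: eq_bigr => i _.
  by rewrite vE !mxE; ring.
exists (1%:M - b *: (v^T *m v)); split.
- by rewrite linearB /= linearZ /= trmx1 trmx_mul trmxK.
- have WW : v^T *m v *m (v^T *m v) = sqn v *: (v^T *m v).
    by rewrite mulmxA -(mulmxA v^T v) vv mul_mx_scalar -scalemxAl.
  rewrite mulmxBl mul1mx mulmxBr mulmx1 -scalemxAl -scalemxAr WW !scalerA.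
  have -> : b * b * sqn v = b + b by rewrite /b; field.
  by rewrite scalerDl opprB addrK subrK.
- rewrite mulmxBr mulmx1 -scalemxAr mulmxA zv mul_scalar_mx scalerA.
  have -> : b * (sqn v / 2) = 1 by rewrite /b; field.
  by rewrite scale1r vE opprB addrC subrK.
Qed.

Variable gamma : probability (BorelMx R d) R.
Hypothesis Hgamma : @rotation_invariant_grass_measure R d k gamma.

Lemma gamma_setI_grass (B : set (BorelMx R d)) :
  measurable B -> gamma (B `&` @grass R d k) = gamma B.
Proof.
move=> mB; have [g1 _] := Hgamma; have mG := measurable_grass.
apply/eqP; rewrite eq_le; apply/andP; split.
  by apply: le_measure; rewrite ?inE //; exact: measurableI.
rewrite (measureDI gamma mB mG).
rewrite [X in (X + _)%E](_ : _ = 0%E) ?add0e //.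
apply/eqP; rewrite eq_le measure_ge0 andbT.
have <- : gamma (~` @grass R d k) = 0%E.
  by rewrite probability_setC // g1 subee.
by apply: le_measure; rewrite ?inE //; [exact: measurableD|exact: measurableC].
Qed.

(** Conjugation by the reflection taking [z] to [z'] carries one set of planes to the other and
    preserves [gamma]. *)
Lemma gamma_small_projection_eq z z' c :
  sqn z = sqn z' -> gamma (small_projection z c) = gamma (small_projection z' c).
Proof.
move=> zz; have [U [Us UU zU]] := reflection_between zz.
have [_ inv] := Hgamma.
have E P : sqn (z *m (U *m P *m U^T)) = sqn (z' *m P).
  by rewrite !mulmxA zU sqn_orth // !Us.
rewrite -(inv U _ (small_projection z c)); [|by rewrite Us|exact: measurable_small_projection].
by congr (gamma _); apply/seteqP; split => P; rewrite /small_projection /= E.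
Qed.

(* The grid points [w] in [{0..n}^d] serve as a discrete substitute for the
   uniform measure on the sphere. *)
Lemma gamma_small_projection_le (n : nat) z (c : R) :
  (0 < n)%N -> (k <= d)%N -> z != 0 -> n%:R ^+ 2 * c <= sqn z ->
  (gamma (small_projection z c) <= ((2 * d ^ 2).+1%:R ^+ k / n.+1%:R ^+ k)%:E)%E.
Proof.
move=> n0 kd z0 ncz.
pose I := {ffun 'I_d -> 'I_n.+1}.
pose B (i : I) := small_projection (gridv R i) d%:R.
have mB i : measurable (B i) by exact: measurable_small_projection.
have zB i : (gamma (small_projection z c) <= gamma (B i))%E.
  rewrite /B; set v := gridv R i.
  have [v0|] := eqVneq v 0.
    apply: le_measure; rewrite ?inE; try exact: measurable_small_projection.
    move=> P _; rewrite /small_projection /= v0 mul0mx.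
    have -> : sqn (0 : 'rV[R]_d) = 0 by apply/eqP; rewrite sqn_eq0.
    exact: ler0n.
  rewrite -sqn_gt0 => v0.
  have z0' : 0 < sqn z by rewrite sqn_gt0.
  (* [a] scales the grid point [v] to the length of [z]. Then [|a v P|^2 <= c] yields [|v P|^2 <= c
     |v|^2 / |z|^2 <= c d n^2 / |z|^2 <= d]. *)
  pose a := Num.sqrt (sqn z / sqn v).
  have a2 : a ^+ 2 = sqn z / sqn v by rewrite sqr_sqrtr // divr_ge0 // ltW.
  have av : sqn z = sqn (a *: v) by rewrite sqnZ a2 divfK // gt_eqF.
  rewrite (gamma_small_projection_eq _ av); apply: le_measure.
  - by rewrite inE; exact: measurable_small_projection.
  - by rewrite inE; exact: measurable_small_projection.
  move=> P /=; rewrite /small_projection /= -scalemxAl sqnZ a2 => H.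
  have n20 : 0 < n%:R ^+ 2 :> R by rewrite exprn_gt0 // ltr0n.
  have := sqn_gridv R i; rewrite -/v => vn.
  have {}H : sqn z * sqn (v *m P) <= c * sqn v.
    by move: H; rewrite mulrAC ler_pdivrMr.
  rewrite -(ler_pM2l z0'); apply: le_trans H _.
  rewrite -(ler_pM2l n20) mulrA.
  apply: le_trans (_ : sqn z * sqn v <= _); first by rewrite ler_wpM2r // ltW.
  by rewrite [leRHS]mulrCA ler_pM2l // [leRHS]mulrC.
have [g1 _] := Hgamma.
pose N := (n.+1 ^ (d - k) * (2 * d ^ 2).+1 ^ k)%N.
have hitsN P : @grass R d k P -> hits R B P <= N%:R.
  move=> [Ps [PP rP]].
  apply: le_trans (_ : (#|[set w : {ffun 'I_d -> 'I_n.+1} |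
    (sqn (gridv R w *m P) <= d%:R)%R]%SET|)%:R <= _); last first.
    by rewrite ler_nat; exact: card_small_projection.
  rewrite -sum1_card natr_sum big_mkcond; apply: ler_sum => w _.
  rewrite indicE; have -> : (P \in B w) = (sqn (gridv R w *m P) <= d%:R) by apply/asboolP/idP.
  by rewrite finset.in_set; case: ifP.
have sumB : (\sum_(i : I) gamma (B i) <= N%:R%:E)%E.
  have := sum_measure_le_hits gamma mB measurable_grass hitsN (ler0n _ _).
  rewrite [X in (_ <= _ * X)%E](_ : _ = 1%E) // mule1; apply: le_trans; apply: lee_sum => i _.
  by rewrite -[leLHS](gamma_setI_grass (mB i)).
have {}sumB : (\sum_(i : I) gamma (small_projection z c) <= N%:R%:E)%E.
  by apply: le_trans sumB; apply: lee_sum => i _.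
have gfin : gamma (small_projection z c) \is a fin_num.
  by apply: fin_num_measure; exact: measurable_small_projection.
move: sumB; rewrite -(fineK gfin) sumEFin !lee_fin sumr_const card_ffun !card_ord.
move: (fine _) => g; rewrite -[leLHS]mulr_natr /N natrM !natrX => H.
(* Dividing by the [(n + 1) ^ d] grid points cancels the factor [(n + 1) ^ (d - k)] of [N]. *)
have E : n.+1%:R ^+ d = n.+1%:R ^+ (d - k) * n.+1%:R ^+ k :> R by rewrite -exprD subnK.
rewrite E in H.
have n1 : 0 < n.+1%:R :> R by [].
rewrite ler_pdivlMr ?exprn_gt0 //.
by move: H; rewrite mulrCA ler_pM2l ?exprn_gt0.
Qed.


End Grassmannian.

(** * Coverings and separated sets *)

(** Cauchy-Schwarz for the fibre sizes [a t] of [c]: they add up to [n], and their squares add up to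
    the number of colliding ordered pairs, diagonal included. *)
Lemma leq_sqr_card_collisions (n : nat) (T : finType) (c : 'I_n -> T) :
  (n ^ 2 <= #|T| * \sum_(p : 'I_n * 'I_n) (c p.1 == c p.2))%N.
Proof.
pose a t := (\sum_(i < n) (c i == t))%N.
have suma : (\sum_t a t = n)%N.
  rewrite /a exchange_big /= -[RHS]card_ord -sum1_card; apply: eq_bigr => i _.
  by rewrite (bigD1 (c i)) //= eqxx big1 // => t /negbTE; rewrite eq_sym => ->.
have sumaa : (\sum_t a t ^ 2 = \sum_(p : 'I_n * 'I_n) (c p.1 == c p.2))%N.
  rewrite -(pair_bigA _ (fun i j => (c i == c j) : nat)) /=.
  transitivity (\sum_t \sum_(i < n) \sum_(j < n) (c i == t) * (c j == t))%N.
    apply: eq_bigr => t _; rewrite -mulnn big_distrl /=; apply: eq_bigr => i _.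
    by rewrite big_distrr.
  rewrite exchange_big /=; apply: eq_bigr => i _; rewrite exchange_big /=.
  apply: eq_bigr => j _; rewrite (bigD1 (c i)) //= eqxx mul1n big1 ?addn0.
    by rewrite eq_sym.
  by move=> t /negbTE; rewrite eq_sym => ->.
rewrite -sumaa -{1}suma -(leq_pmul2l (m:=2)) // -mulnn big_distrlr /=.
rewrite big_distrr /=.
apply: (@leq_trans (\sum_s \sum_t (a s ^ 2 + a t ^ 2))).
  by apply: leq_sum => s _; rewrite big_distrr; apply: leq_sum => t _; apply: nat_Cauchy.
under eq_bigr do rewrite big_split /= sum_nat_const.
rewrite big_split /= sum_nat_const -big_distrr /=; by rewrite mul2n addnn.
Qed.

Section Coverings.
Variables (R : realType) (d : nat).
Implicit Types (x y z : 'rV[R]_d) (E X : set 'rV[R]_d) (r : R) (n : nat).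

Lemma edistE x y : edist x y = Num.sqrt (sqn (x - y)).
Proof. by congr Num.sqrt; apply: eq_bigr => i _; rewrite !mxE. Qed.

Lemma edist_nneg x y : 0 <= edist x y.
Proof. by rewrite edistE sqrtr_ge0. Qed.

Lemma edistxx x : edist x x = 0.
Proof. by rewrite edistE subrr (_ : sqn 0 = 0) ?sqrtr0 //; apply/eqP; rewrite sqn_eq0. Qed.

Lemma edist_le x y r : 0 <= r -> (edist x y <= r) = (sqn (x - y) <= r ^+ 2).
Proof. by move=> r0; rewrite edistE -[RHS]ler_sqrt ?exprn_ge0 // sqrtr_sqr ger0_norm. Qed.

Lemma edist_ge x y r : 0 <= r -> (r <= edist x y) = (r ^+ 2 <= sqn (x - y)).
Proof. by move=> r0; rewrite edistE -[RHS]ler_sqrt ?sqn_ge0 // sqrtr_sqr ger0_norm. Qed.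

Lemma ediam_leP E r :
  (ediam E <= r%:E)%E <-> forall x y, E x -> E y -> edist x y <= r.
Proof.
split=> [H x y Ex Ey|H].
  by rewrite -lee_fin; apply: le_trans H; apply: ereal_sup_ubound; exists (x, y).
by apply: ge_ereal_sup => _ [[x y] [/= Ex Ey] <-]; rewrite lee_fin H.
Qed.

(** The case of equal radii follows from [|z + u|^2 <= 2 |z|^2 + 2 |u|^2], because
    [2 (r/2)^2 + 2 (r/2)^2 = r^2]. *)
Lemma edist_le_of_center x y z r : 0 <= r ->
  edist x z <= r / 2 -> edist y z <= r / 2 -> edist x y <= r.
Proof.
move=> r0; have r20 : 0 <= r / 2 by rewrite divr_ge0.
rewrite !edist_le // => H1 H2.
have -> : x - y = (x - z) + - (y - z) by rewrite opprB addrA subrK.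
apply: le_trans (sqnD_le _ _) _; rewrite sqnN.
by have := lerD H1 H2; rewrite expr_div_n; lra.
Qed.

Lemma coverableS E r n m : (n <= m)%N -> coverable E r n -> coverable E r m.
Proof.
move=> nm [F [Fr EF]]; exists (fun i => if (i < n)%N then F i else set0); split.
  move=> i _; case: ifP => [/Fr //|_]; apply/ediam_leP => x y //.
move=> x /EF [i /= ni Fx]; exists i; first exact: leq_trans ni nm.
by rewrite ni.
Qed.

(** Greedy choice: if no further point were far from those already chosen, the closed balls of
    radius [r / 2] about them, of diameter at most [r], would cover [X]. Indices run up to [n]
    inclusive, so [n + 1] points are obtained. *)
Lemma not_coverable_separated X r n : 0 <= r -> ~ coverable X r n ->
  exists f : nat -> 'rV[R]_d, (forall i, (i <= n)%N -> X (f i)) /\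
    forall i j, (i < j)%N -> (j <= n)%N -> r / 2 < edist (f i) (f j).
Proof.
move=> r0; elim: n => [|n IH] ncov.
  have [x Xx] : X !=set0.
    apply/set0P/eqP => X0; apply: ncov; exists (fun=> set0); split => //.
    by rewrite X0; exact: sub0set.
  exists (fun=> x); split => // i j; rewrite leqn0 => + /eqP j0; by rewrite j0.
have [f [fX fsep]] : exists f : nat -> 'rV[R]_d, (forall i, (i <= n)%N -> X (f i)) /\
    forall i j, (i < j)%N -> (j <= n)%N -> r / 2 < edist (f i) (f j).
  by apply: IH => cov; apply: ncov; apply: coverableS cov.
have [x [Xx xf]] : exists x, X x /\ forall i, (i <= n)%N -> r / 2 < edist (f i) x.
  apply: contrapT => H; apply: ncov.
  exists (fun i => [set x | edist (f i) x <= r / 2]); split.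
    move=> i _; apply/ediam_leP => x y /= xi yi.
    apply: (@edist_le_of_center _ _ (f i)) => //.
      by rewrite edistE -sqnN opprB -edistE.
    by rewrite edistE -sqnN opprB -edistE.
  move=> x Xx; apply: contrapT => xf; apply: H; exists x; split => // i ni.
  by rewrite ltNge; apply/negP => fi; apply: xf; exists i.
exists (fun i => if (i <= n)%N then f i else x); split => [i _|i j ij].
  by case: ifP => // /fX.
rewrite leq_eqVlt => /orP [/eqP jn|]; last first.
  rewrite ltnS => jn; rewrite jn (leq_trans (ltnW ij) jn); exact: fsep.
by rewrite jn ltnn -ltnS -jn ij; apply: xf; rewrite -ltnS -jn.
Qed.

Lemma covnum_le_coverable E r c : (covnum E r <= c%:E)%E -> exists n, coverable E r n.
Proof.
move=> H; apply: contrapT => nex.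
have : covnum E r = +oo%E.
  rewrite /covnum (_ : [set n | coverable E r n] = set0) ?image_set0 ?ereal_inf0 //.
  by apply/seteqP; split => n //= ?; apply: nex; exists n.
by move=> E'; move: H; rewrite E' leye_eq.
Qed.

(** Pigeonhole: a set of diameter at most [r] contains at most one of the points. *)
Lemma card_separated_le_covnum (m : nat) (x : 'I_m -> 'rV[R]_d) (A : {set 'I_m}) E r :
  (forall i, i \in A -> E (x i)) ->
  (forall i j, i != j -> r < edist (x i) (x j)) ->
  ((#|A|%:R)%:E <= covnum E r)%E.
Proof.
move=> AE sep; apply: le_ereal_inf_tmp => _ [n [F [Fr EF]] <-].
rewrite lee_fin ler_nat.
(* The type ['I_n.+1] is inhabited even for [n = 0] and so offers a default value off [A]; on [A]
   the value [ord_max] is avoided, which restores the bound [n]. *)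
have /choice [c cP] : forall i : 'I_m, exists j : 'I_n.+1, i \in A -> (j < n)%N /\ F j (x i).
  move=> i; case: (boolP (i \in A)) => [iA|_]; last by exists ord0.
  have [j /= jn Fx] := EF _ (AE _ iA); exists (inord j) => _.
  by rewrite inordK // ltnS ltnW.
have cinj : {in A &, injective c}.
  move=> i j iA jA cij; apply/eqP; apply: contraT => /sep.
  have [cn Fi] := cP _ iA; have [_ Fj] := cP _ jA; rewrite -cij in Fj.
  by have /ediam_leP/(_ _ _ Fi Fj) := Fr _ cn; rewrite leNgt => /negbTE ->.
rewrite -(card_in_imset cinj).
have cardn : #|[set: 'I_n.+1] :\ ord_max|%SET = n.
  by have := cardsD1 ord_max [set: 'I_n.+1]%SET;
    rewrite cardsT card_ord finset.in_setT add1n => -[].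
rewrite -[leqRHS]cardn; apply: subset_leq_card; apply/fintype.subsetP => j /imsetP [i iA ->].
rewrite !inE andbT; have [cn _] := cP _ iA.
by apply/eqP => E'; move: cn; rewrite E' /= ltnn.
Qed.

End Coverings.

(** * Dyadic shells *)

Section Shells.
Variables (R : realType) (d k : nat).
Implicit Types (x y z : 'rV[R]_d) (r rho : R) (n : nat).

Definition assouad_bound (X : set 'rV[R]_d) (a C : R) : Prop :=
  forall (r Rr : R) x, 0 < r -> r < Rr -> X x ->
    (covnum (eball x Rr `&` X) r <= (C * (Rr / r) `^ a)%:E)%E.

Definition spectrum_bound (theta : R) (X : set 'rV[R]_d) (a C : R) : Prop :=
  forall (r Rr : R) x, 0 < r -> r <= Rr `^ theta^-1 ->
    Rr `^ theta^-1 < Rr -> Rr < 1 -> X x ->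
    (covnum (eball x Rr `&` X) r <= (C * (Rr / r) `^ a)%:E)%E.

Lemma powR_expR (x a : R) : 0 < x -> x `^ a = expR (a * ln x).
Proof. by move=> x0; rewrite /powR gt_eqF. Qed.

(** With [u = ln q] and [v = ln rho], the claim for an exponent [a] reads [(a - k) u <= - m v].
    Below the threshold [rho ^ theta] the Assouad bound applies and [u < (1 - theta) (- v)]; above
    it the spectrum applies and [u < - v], as the radius is less than 1. *)
Lemma local_cover_bound (X : set 'rV[R]_d) (theta a1 a2 C m : R) (q rho : R) y :
  0 < theta -> theta < 1 -> 0 < C ->
  spectrum_bound theta X a1 C -> assouad_bound X a2 C ->
  0 <= m -> a1 - k%:R <= m -> (a2 - k%:R) * (1 - theta) <= m ->
  0 < rho -> 1 < q -> q * rho < 1 -> X y ->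
  (covnum (eball y (q * rho) `&` X) rho <= (C * rho `^ (- m) * q ^+ k)%:E)%E.
Proof.
move=> th0 th1 C0 spec ass m0 a1m a2m rho0 q1 qrho Xy.
have q0 : 0 < q by apply: lt_trans q1.
have qr0 : 0 < q * rho by apply: mulr_gt0.
have u0 : 0 < ln q by rewrite ln_gt0.
have uv : ln q + ln rho < 0 by rewrite -lnM ?posrE //; apply: ln_lt0; rewrite qr0.
have k0 : 0 <= k%:R :> R by [].
have bnd a : (a - k%:R) * ln q <= - m * ln rho ->
    C * (q * rho / rho) `^ a <= C * rho `^ (- m) * q ^+ k.
  move=> H; rewrite -[leRHS]mulrA ler_pM2l // mulfK ?gt_eqF //.
  rewrite -powR_mulrn ?(ltW q0) // !powR_expR // -expRD ler_expR.
  by move: H; rewrite mulrBl; lra.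
move: a1m a2m bnd u0 uv; set u := ln q; set v := ln rho => a1m a2m bnd u0 uv.
have [small|large] := ltP (u + v) (theta * v).
- apply: le_trans (ass rho (q * rho) y rho0 _ Xy) _; first by rewrite ltr_pMl.
  rewrite lee_fin; apply: bnd.
  (* An exponent at most [k] makes the left side nonpositive, and [m >= 0] suffices. *)
  have [ak|ak] := leP a2 k%:R.
    apply: (@le_trans _ _ 0); first by rewrite mulr_le0_ge0 ?subr_le0 // ltW.
    by rewrite mulNr -mulrN mulr_ge0 // oppr_ge0; lra.
  have ak' : 0 < a2 - k%:R by rewrite subr_gt0.
  apply: (@le_trans _ _ ((a2 - k%:R) * ((1 - theta) * - v))).
    by rewrite ler_pM2l //; lra.
  by rewrite mulrA mulNr -mulrN ler_wpM2r //; lra.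
- have lnqr : ln (q * rho) = u + v by rewrite lnM ?posrE.
  apply: le_trans (spec rho (q * rho) y rho0 _ _ qrho Xy) _.
  + rewrite powR_expR // lnqr -[leLHS]lnK ?posrE // ler_expR -/v.
    by rewrite mulrC ler_pdivlMr // mulrC.
  + rewrite powR_expR // lnqr -[ltRHS]lnK ?posrE // ltr_expR lnqr.
    by rewrite mulrC ltr_pdivrMr //; nra.
  rewrite lee_fin; apply: bnd.
  have [ak|ak] := leP a1 k%:R.
    apply: (@le_trans _ _ 0); first by rewrite mulr_le0_ge0 ?subr_le0 // ltW.
    by rewrite mulNr -mulrN mulr_ge0 // oppr_ge0; lra.
  have ak' : 0 < a1 - k%:R by rewrite subr_gt0.
  apply: (@le_trans _ _ ((a1 - k%:R) * - v)); first by rewrite ler_pM2l //; lra.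
  by rewrite mulNr -mulrN ler_wpM2r //; lra.
Qed.

Variable gamma : probability (BorelMx R d) R.
Hypothesis Hgamma : @rotation_invariant_grass_measure R d k gamma.
Hypothesis kd : (k <= d)%N.

(** The power of [2 * d ^ 2 + 1] comes from the grid estimate; [2 ^ k] pays for replacing the inner
    radius of a dyadic shell by the outer one. *)
Definition shell_const : R := 2 ^+ k * (2 * d ^ 2).+1%:R ^+ k.

(** The least [j] with [|x - y| < 2 ^ (j + 1) * rho] also gives [2 ^ j * rho <= |x - y|] when
    [x != y], so the grid estimate applies with [n = 2 ^ j]. For [x = y] one has [j = 0] and the
    bound is at least 1. The limit [1 / 4] keeps the outer radius below 1. *)
Lemma gamma_pair_shell rho x y : 0 < rho -> rho <= 1 / 4 ->
  (x != y -> rho < edist x y) -> edist x y <= 1 / 4 ->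
  exists j, [/\ 2 ^+ j.+1 * rho < 1, edist x y < 2 ^+ j.+1 * rho &
   (gamma (small_projection (x - y) (rho ^+ 2)) <= (shell_const / (2 ^+ j.+1) ^+ k)%:E)%E].
Proof.
move=> rho0 rho4 sep near.
have D1 : 1 <= (2 * d ^ 2).+1%:R ^+ k :> R by rewrite exprn_ege1 // ler1n.
have two0 n : 0 < 2 ^+ n :> R by rewrite exprn_gt0.
have exj : exists j, edist x y < 2 ^+ j.+1 * rho.
  exists (Num.truncn rho^-1).
  apply: le_lt_trans near _.
  rewrite -ltr_pdivrMr //.
  have inv0 : 0 < rho^-1 by rewrite invr_gt0.
  apply: (@lt_trans _ _ rho^-1); first by lra.
  apply: lt_trans (truncnS_gt _) _.
  by rewrite -natrX ltr_nat; exact: ltn_expl.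
have [j jP jmin] := ex_minnP exj.
exists j; split => //.
  case: j jP jmin => [|j] _ jmin; first by rewrite expr1; lra.
  have : 2 ^+ j.+1 * rho <= edist x y.
    by rewrite leNgt; apply/negP => /jmin; rewrite ltnn.
  by rewrite (exprS _ j.+1) -mulrA; lra.
have [xy|xy] := eqVneq x y.
  have -> : j = 0%N.
    by apply/eqP; rewrite -leqn0; apply: jmin; rewrite xy edistxx mulr_gt0.
  apply: le_trans (probability_le1 _ _) _; first exact: measurable_small_projection.
  by rewrite lee_fin /shell_const expr1 mulrAC divff ?mul1r // gt_eqF.
have ge : 2 ^+ j * rho <= edist x y.
  case: j jmin {jP} => [|j] jmin; first by rewrite mul1r ltW // sep.
  by rewrite leNgt; apply/negP => /jmin; rewrite ltnn.
apply: le_trans (gamma_small_projection_le Hgamma (n := 2 ^ j) _ kd _ _) _.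
- by rewrite expn_gt0.
- by rewrite subr_eq0.
- have g0 : 0 <= 2 ^+ j * rho by rewrite ltW // mulr_gt0.
  by move: ge; rewrite edist_ge // exprMn natrX.
rewrite lee_fin /shell_const (exprS _ j) exprMn -mulf_div divff ?gt_eqF ?mul1r //.
rewrite ler_pM2l ?(lt_le_trans _ D1) // lef_pV2 ?posrE ?exprn_gt0 //.
by apply: lerXn2r; rewrite ?nnegrE ?ler0n // -?natrX ?ler_nat ?ler0n.
Qed.

(** Pairs more than [1 / 4] apart are discarded, since the spectrum only controls balls of radius
    less than 1. Later the points are sorted into finitely many pieces of diameter [1 / 4], so that
    only close pairs are counted. *)
Definition near_collision n (x : 'I_n -> 'rV[R]_d) rho (p : 'I_n * 'I_n) :
    set (BorelMx R d) :=
  if edist (x p.1) (x p.2) <= 1 / 4 then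
    small_projection (x p.1 - x p.2) (rho ^+ 2) else set0.

Lemma measurable_near_collision n (x : 'I_n -> 'rV[R]_d) rho p :
  measurable (near_collision x rho p).
Proof.
rewrite /near_collision; case: ifP => _; last exact: measurable0.
exact: measurable_small_projection.
Qed.

(** For fixed [i], the shell [j] holds at most [L * (2 ^ (j + 1)) ^ k] points, which cancels the
    weight of a pair in that shell. Each of the [J] shells then contributes at most
    [shell_const * L]. *)
Lemma sum_gamma_near_collision (X : set 'rV[R]_d) n (x : 'I_n -> 'rV[R]_d) rho (L : R)
    (J : nat) :
  0 < rho -> rho <= 1 / 4 -> 0 <= L ->
  (forall i, X (x i)) ->
  (forall i j, i != j -> rho < edist (x i) (x j)) ->
  (forall j, 2 ^+ j.+1 * rho < 1 -> (j < J)%N) ->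
  (forall j y, 2 ^+ j.+1 * rho < 1 -> X y ->
     (covnum (eball y (2 ^+ j.+1 * rho) `&` X) rho <= (L * (2 ^+ j.+1) ^+ k)%:E)%E) ->
  (\sum_p gamma (near_collision x rho p) <= (n%:R * (J%:R * (shell_const * L)))%:E)%E.
Proof.
move=> rho0 rho4 L0 xX sep HJ HL.
have shell_const_ge0 : 0 <= shell_const by rewrite /shell_const mulr_ge0 ?exprn_ge0.
pose w (i i' : 'I_n) (j : nat) : R :=
  (edist (x i) (x i') < 2 ^+ j.+1 * rho)%R%:R * (shell_const / (2 ^+ j.+1) ^+ k).
have w0 i i' j : 0 <= w i i' j.
  by rewrite /w mulr_ge0 ?ler0n // divr_ge0 // !exprn_ge0.
pose good (j : 'I_J) := 2 ^+ j.+1 * rho < 1.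
have pairw i i' : (gamma (near_collision x rho (i, i')) <=
    (\sum_(j < J | good j) w i i' j)%:E)%E.
  rewrite /near_collision /=; case: ifP => [near|_]; last first.
    by rewrite measure0 lee_fin sumr_ge0.
  have [|j [j1 jlt jg]] := gamma_pair_shell rho0 rho4 _ near.
    by move=> xx; apply: sep; apply: contraNneq xx => ->.
  apply: le_trans jg _; rewrite lee_fin (bigD1 (Ordinal (HJ _ j1))) //=.
  by rewrite {1}/w /= jlt mul1r lerDl sumr_ge0.
have cnt i (j : 'I_J) : good j -> \sum_(i' < n) w i i' j <= shell_const * L.
  move=> gj; rewrite /w -mulr_suml.
  have := HL _ _ gj (xX i).
  set A := [set i' | (edist (x i) (x i') < 2 ^+ j.+1 * rho)%R]%SET.
  have AE i' : i' \in A -> (eball (x i) (2 ^+ j.+1 * rho) `&` X) (x i').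
    by rewrite finset.in_set => ii'; split => //; exact: xX.
  move=> /(le_trans (card_separated_le_covnum AE sep)); rewrite lee_fin => H1.
  have p0 : 0 < (2 ^+ j.+1) ^+ k :> R by rewrite !exprn_gt0.
  rewrite mulrCA ler_wpM2l // ler_pdivrMr //; apply: le_trans H1.
  by rewrite -sum1_card natr_sum [leRHS]big_mkcond; apply: ler_sum => i' _;
    rewrite finset.in_set; case: ifP.
rewrite -(pair_bigA _ (fun i i' => gamma (near_collision x rho (i, i')))) /=.
apply: (@le_trans _ _ (\sum_(i < n) (J%:R * (shell_const * L))%:E)%E).
  apply: lee_sum => i _.
  apply: (@le_trans _ _ (\sum_(i' < n) (\sum_(j < J | good j) w i i' j)%:E)%E).
    by apply: lee_sum => i' _; exact: pairw.
  rewrite sumEFin lee_fin exchange_big /=.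
  apply: (@le_trans _ _ (\sum_(j < J | good j) (shell_const * L))).
    by apply: ler_sum => j; exact: cnt.
  rewrite big_mkcond /=; apply: (@le_trans _ _ (\sum_(j < J) (shell_const * L))).
    by apply: ler_sum => j _; case: ifP => // _; rewrite mulr_ge0.
  by rewrite sumr_const card_ord -[leLHS]mulr_natl.
by rewrite sumEFin sumr_const card_ord -[X in X%:E]mulr_natl.
Qed.

(** About [log_2 (1 / rho)] scales fit below 1, and [1 + s <= exp s] at [s = - e * ln rho] turns the
    logarithm into a small power. *)
Lemma dyadic_scales_count (e : R) : 0 < e -> forall rho, 0 < rho -> rho < 1 ->
  exists J : nat, (forall j, 2 ^+ j.+1 * rho < 1 -> (j < J)%N) /\
    J%:R <= (e * ln 2)^-1 * rho `^ (- e).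
Proof.
move=> e0 rho rho0 rho1.
have l2 : 0 < ln 2 :> R by rewrite ln_gt0 // ltr1n.
have v0 : 0 < - ln rho by rewrite oppr_gt0 ln_lt0 // rho0.
exists (Num.truncn (- ln rho / ln 2)); split.
  move=> j H; rewrite truncn_ge_nat; last by rewrite divr_ge0 // ltW.
  rewrite ler_pdivlMr // mulr_natl -lnXn // -subr_ge0 -opprD oppr_ge0.
  by rewrite addrC -lnM ?posrE ?exprn_gt0 //; apply: ln_le0; apply: ltW.
have /andP [+ _] := truncn_itv (divr_ge0 (ltW v0) (ltW l2)).
move/le_trans; apply.
rewrite invfM mulrAC ler_pM2r ?invr_gt0 // ler_pdivlMl // powR_expR //.
rewrite mulNr -mulrN; apply: le_trans (expR_ge1Dx _).
by rewrite lerDr.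
Qed.

End Shells.

(** * Exceptional planes *)

Section BoxRatio.
Variables (R : realType) (d : nat).
Implicit Types (E X : set 'rV[R]_d) (r t : R).

Lemma box_ratio_ge E r t : 0 < r -> r < 1 ->
  ((r `^ (- t))%:E <= covnum E r)%E -> (t%:E <= box_ratio E r)%E.
Proof.
move=> r0 r1; rewrite /box_ratio; case: (covnum E r) => [N||];
  [|by rewrite !leey|by rewrite leeNy_eq].
have l0 : 0 < - ln r by rewrite oppr_gt0 ln_lt0 // r0.
rewrite !lee_fin => H; rewrite ler_pdivlMr //.
have N0 : 0 < N by apply: lt_le_trans H; rewrite powR_gt0.
by rewrite mulrN -mulNr -ln_powR ler_ln ?posrE // powR_gt0.
Qed.

Lemma covnum_ge1 E r : E !=set0 -> (1%:E <= covnum E r)%E.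
Proof.
move=> [x Ex]; apply: le_ereal_inf_tmp => _ [n [F [_ EF]] <-].
by rewrite lee_fin ler1n; have [i /= ni _] := EF _ Ex; apply: leq_ltn_trans ni.
Qed.

(** Non-emptiness rules out the covering number 0, at which [ln] takes a default value; from 1 on
    the ratio is monotone in the covering number. *)
Lemma box_ratio_gt_not_coverable X r t n : X !=set0 -> 0 < r -> r < 1 ->
  (t%:E < box_ratio X r)%E -> n%:R <= r `^ (- t) -> ~ coverable X r n.
Proof.
move=> X0 r0 r1 + nr cov.
have : (covnum X r <= n%:R%:E)%E by apply: ereal_inf_lbound; exists n.
have := covnum_ge1 r X0; rewrite /box_ratio; case: (covnum X r) => [N| |] //.
have l0 : 0 < - ln r by rewrite oppr_gt0 ln_lt0 // r0.
rewrite !lee_fin lte_fin => N1 Nn; rewrite ltr_pdivlMr //.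
have N0 : 0 < N by apply: lt_le_trans N1.
rewrite mulrN -mulNr -ln_powR ltr_ln ?posrE ?powR_gt0 // => H.
by have := lt_le_trans H (le_trans Nn nr); rewrite ltxx.
Qed.

End BoxRatio.

Lemma negligible_of_small_covers (R : realType) (dsp : measure_display)
    (T : measurableType dsp) (mu : {measure set T -> \bar R}) (B : set T) :
  (forall e : R, 0 < e -> exists G, [/\ measurable G, (mu G <= e%:E)%E & B `<=` G]) ->
  mu.-negligible B.
Proof.
move=> H.
have /choice [G GP] : forall i : nat, exists G,
    [/\ measurable G, (mu G <= (i.+1%:R^-1 : R)%:E)%E & B `<=` G].
  by move=> i; apply: H.
have mG : measurable (\bigcap_i G i) by apply: bigcap_measurable => // i _; have [] := GP i.
exists (\bigcap_i G i); split => //; last by move=> x Bx i _; have [_ _] := GP i; apply.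
apply/eqP; rewrite eq_le measure_ge0 andbT; apply/lee_addgt0Pr => e e0; rewrite add0e.
have [mGi Gi _] := GP (Num.truncn e^-1).
apply: (@le_trans _ _ (mu (G (Num.truncn e^-1)))).
  by apply: le_measure; rewrite ?inE // => x; apply.
apply: le_trans Gi _; rewrite lee_fin -[leRHS]invrK lef_pV2 ?posrE ?invr_gt0 //.
exact/ltW/truncnS_gt.
Qed.

Section Projections.
Variables (R : realType) (d k : nat) (gamma : probability (BorelMx R d) R).
Hypothesis Hgamma : @rotation_invariant_grass_measure R d k gamma.
Hypothesis kd : (k <= d)%N.
Variables (X : set 'rV[R]_d) (theta a1 a2 C m : R).
Hypothesis HXb : ebounded X.
Hypothesis HX0 : X !=set0.
Hypothesis th0 : 0 < theta.
Hypothesis th1 : theta < 1.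
Hypothesis C0 : 0 < C.
Hypothesis spec : spectrum_bound theta X a1 C.
Hypothesis ass : assouad_bound X a2 C.
Hypothesis m0 : 0 <= m.
Hypothesis a1m : a1 - k%:R <= m.
Hypothesis a2m : (a2 - k%:R) * (1 - theta) <= m.

(** A single ball contains [X], and the Assouad bound makes its covering number at scale [1 / 4]
    finite. *)
Lemma bounded_coverable_quarter : exists K, coverable X (1 / 4) K.
Proof.
have [x0 Xx0] := HX0; have [M HM] := HXb.
have M0 : 0 <= M by exact: le_trans (edist_nneg _ _) (HM _ Xx0).
have sub : X `<=` eball x0 (2 * M + 1) `&` X.
  move=> x Xx; split => //; rewrite /eball /=.
  apply: (@le_lt_trans _ _ (2 * M)); last by rewrite ltrDl.
  have cen y : X y -> edist y 0 <= 2 * M / 2.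
    by move=> Xy; rewrite mulrAC divff // mul1r edistE -sqnN opprB -edistE HM.
  by apply: (@edist_le_of_center _ _ _ _ 0); rewrite ?mulr_ge0 //; exact: cen.
have [K [F [FK EF]]] : exists K, coverable (eball x0 (2 * M + 1) `&` X) (1 / 4) K.
  by apply: covnum_le_coverable; apply: ass => //; lra.
by exists K, F; split => //; exact: subset_trans EF.
Qed.

(** [G] collects the planes with at least [lam] near collisions. Their expected number is at most
    [n * C2 * rho ^ (- (m + e))], the loss [e] coming from the number of scales; the second [e] in
    [lam] is what Markov's inequality turns into [rho ^ e]. *)
Lemma exceptional_set (K : nat) (e : R) : coverable X (1 / 4) K -> 0 < e ->
  exists C2 : R, 0 < C2 /\ forall (rho : R) (n : nat) (x : 'I_n -> 'rV[R]_d),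
    0 < rho -> rho <= 1 / 4 -> (0 < n)%N -> (forall i, X (x i)) ->
    (forall i j, i != j -> rho < edist (x i) (x j)) ->
    exists G : set (BorelMx R d), [/\ measurable G,
      (gamma G <= (C2 * rho `^ e)%:E)%E &
      forall P : 'M[R]_d, ~ G P -> forall N, coverable (projV P X) rho N ->
        n%:R <= N%:R * K%:R * rho `^ (- (m + 2 * e))].
Proof.
move=> [E [EK XE]] e0.
have l2 : 0 < ln 2 :> R by rewrite ln_gt0 // ltr1n.
have sc0 : 0 < shell_const R d k by rewrite /shell_const mulr_gt0 ?exprn_gt0.
pose C2 := (e * ln 2)^-1 * (shell_const R d k * C).
have C20 : 0 < C2 by rewrite /C2 !(mulr_gt0, invr_gt0).
exists C2; split => // rho n x rho0 rho4 n0 xX sep.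
have rho1 : rho < 1 by lra.
have p0 a : 0 < rho `^ a by rewrite powR_gt0.
have [J [HJ Jle]] := dyadic_scales_count e0 rho0 rho1.
pose lam := n%:R * rho `^ (- (m + 2 * e)).
have nR : 0 < n%:R :> R by rewrite ltr0n.
have lam0 : 0 < lam by rewrite mulr_gt0.
pose B := near_collision x rho.
have mB p : measurable (B p) by exact: measurable_near_collision.
have sumB : (\sum_p gamma (B p) <= (n%:R * (C2 * rho `^ (- (m + e))))%:E)%E.
  have := sum_gamma_near_collision (X := X) (x := x) Hgamma kd rho0 rho4
    (L := C * rho `^ (- m)) _ xX sep HJ.
  move=> H; apply: le_trans (H _ _) _.
  - by rewrite mulr_ge0 // ltW.
  - move=> j y j1 Xy; apply: (local_cover_bound (theta := theta) (a1 := a1) (a2 := a2)) => //.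
    by rewrite exprn_egt1 // ltr1n.
  rewrite lee_fin ler_pM2l //.
  apply: (@le_trans _ _ ((e * ln 2)^-1 * rho `^ (- e) * (shell_const R d k * (C * rho `^ (- m))))).
    by rewrite ler_pM2r // !mulr_gt0.
  by rewrite opprD powRD ?(gt_eqF rho0) ?implybT // /C2 le_eqVlt;
    apply/orP; left; apply/eqP; ring.
exists [set P | lam <= hits R B P]; split.
- exact: measurable_hits_ge.
- set G := [set x | _]; have gfin : gamma G \is a fin_num.
    by apply: fin_num_measure; exact: measurable_hits_ge.
  have H : (lam%:E * gamma G <= (n%:R * (C2 * rho `^ (- (m + e))))%:E)%E.
    exact: le_trans (hits_markov gamma mB (ltW lam0)) sumB.
  move: H.
  rewrite -(fineK gfin) -EFinM !lee_fin => H.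
  rewrite -(ler_pM2l lam0); apply: le_trans H _.
  rewrite /lam -[leRHS]mulrA ler_pM2l // [leRHS]mulrCA ler_pM2l //.
  rewrite -powRD ?(gt_eqF rho0) ?implybT //.
  by rewrite (_ : - (m + 2 * e) + e = - (m + e)) //; ring.
move=> P /negP; rewrite -ltNge => hlt N [F [FN PF]].
(* Each point is labelled by a piece covering its projection and a piece of diameter [1 / 4]
   containing it. Points with equal labels form a near collision, so Cauchy-Schwarz with [N * K]
   labels applies. *)
have /choice [c cP] : forall i : 'I_n, exists ab : 'I_N * 'I_K,
    F ab.1 (x i *m P) /\ E ab.2 (x i).
  move=> i; have [b bK Eb] := XE _ (xX i).
  have [|a aN Fa] := PF (x i *m P); first by exists (x i).
  by exists (Ordinal aN, Ordinal bK).
have coll : (\sum_(p : 'I_n * 'I_n) (c p.1 == c p.2))%N%:R <= hits R B P.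
  rewrite natr_sum; apply: ler_sum => -[i j] _ /=.
  case: eqP => [cij|_]; last by rewrite indicE ler0n.
  have [Fi Ei] := cP i; have [Fj Ej] := cP j; rewrite -cij in Fj Ej.
  have near : edist (x i) (x j) <= 1 / 4.
    by have /ediam_leP := EK _ (ltn_ord (c i).2); apply.
  rewrite indicE mem_set //= /B /near_collision /= near /small_projection /=.
  rewrite mulmxBl -edist_le ?(ltW rho0) //.
  by have /ediam_leP := FN _ (ltn_ord (c i).1); apply.
have := leq_sqr_card_collisions c; rewrite card_prod !card_ord -(ler_nat R) natrX natrM natrM.
move=> H; rewrite -(ler_pM2l nR) -expr2; apply: le_trans H _.
rewrite mulrCA ler_wpM2l ?mulr_ge0 //.
exact: le_trans coll (ltW hlt).
Qed.

Lemma powR_small_scale (e c : R) : 0 < e -> 0 < c ->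
  exists2 dl, 0 < dl & forall rho, 0 < rho -> rho <= dl -> rho `^ e <= c.
Proof.
move=> e0 c0; exists (c `^ e^-1); first by rewrite powR_gt0.
move=> rho rho0 rhole; have := ge0_ler_powR (ltW e0) _ _ rhole.
rewrite -powRrM mulVf ?gt_eqF // powRr1 ?(ltW c0) //; apply.
  by rewrite nnegrE ltW.
by rewrite nnegrE powR_ge0.
Qed.

(** A plane that is bad at every small scale lies in the exceptional set of any one of them, so one
    suitable scale per [eta] is enough. The third [e] absorbs the constants [K0.+1] and [2 ^ t]. *)
Lemma negligible_small_box_ratios (t e dl : R) :
  (t%:E < upper_box_dim X)%E -> 0 < e -> 0 < dl ->
  gamma.-negligible [set P : BorelMx R d | forall r, 0 < r -> r < dl ->
    (box_ratio (projV (P : 'M[R]_d) X) r < (t - m - 3 * e)%:E)%E].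
Proof.
move=> tX e0 dl0; apply: negligible_of_small_covers => eta eta0.
have [K0 cK0] := bounded_coverable_quarter.
have cK : coverable X (1 / 4) K0.+1 by apply: coverableS cK0.
have [C2 [C20 exc]] := exceptional_set cK e0.
have [d1 d10 d1P] := powR_small_scale e0 (divr_gt0 eta0 C20).
have c20 : 0 < 2 `^ (- t) / K0.+1%:R :> R by rewrite divr_gt0 // powR_gt0.
have [d2 d20 d2P] := powR_small_scale e0 c20.
(* Below [dl] the badness assumption applies, below [1 / 4] the exceptional set exists, below [d1]
   its measure is at most [eta], and below [d2] the constants are absorbed. *)
pose del := Num.min (Num.min dl (1 / 4)) (Num.min d1 d2).
have del0 : 0 < del by rewrite !lt_min dl0 d10 d20 andbT; lra.
have [r [r0 rdel] tr] : exists2 r, 0 < r /\ r < del & (t%:E < box_ratio X r)%E.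
  have tsup : (t%:E < ereal_sup [set box_ratio X r | r in [set r | 0 < r < del]%R])%E.
    apply: lt_le_trans tX _; apply: ereal_inf_lbound.
    exists [set r | 0 < r < del] => //.
    near=> r; apply/andP; split; near: r; first exact: nbhs_right_gt.
    exact: nbhs_right_lt.
  have [_ [r /andP [r0 rd] <-] tr] := ereal_sup_gt tsup.
  by exists r.
move: rdel; rewrite !lt_min => /andP [/andP [rdl r4] /andP [r1 r2]].
pose rho := r / 2; have rho0 : 0 < rho by rewrite divr_gt0.
have rr : rho < r by rewrite /rho; lra.
(* Since [n0 <= r ^ (- t)], [n0] sets cannot cover [X]; this yields [n0 + 1 > r ^ (- t)] points
   separated by more than [rho = r / 2]. *)
pose n0 := Num.truncn (r `^ (- t)).
have ncov : ~ coverable X r n0.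
  apply: (box_ratio_gt_not_coverable HX0 r0 _ tr); first by lra.
  by have /andP [] := truncn_itv (powR_ge0 r (- t)).
have [f [fX fsep]] := not_coverable_separated (ltW r0) ncov.
have [|//|||G [mG Gle GP]] := exc rho n0.+1 (fun i => f i) rho0 => //.
- by lra.
- by move=> i; apply: fX; rewrite -ltnS.
- move=> i j; rewrite neq_ltn => /orP [ij|ij]; first by apply: fsep => //; rewrite -ltnS.
  by rewrite edistE -sqnN opprB -edistE; apply: fsep => //; rewrite -ltnS.
exists G; split => //.
  apply: le_trans Gle _; rewrite lee_fin mulrC -ler_pdivlMr //; apply: d1P => //; lra.
move=> P HP; apply: contrapT => nGP.
have := HP rho rho0 (lt_trans rr rdl); rewrite ltNge => /negP; apply.
apply: box_ratio_ge => //; first by lra.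
apply: le_ereal_inf_tmp => _ [N cN <-]; rewrite lee_fin.
have := GP _ nGP _ cN.
have nge : r `^ (- t) <= n0.+1%:R by exact/ltW/truncnS_gt.
move=> /(le_trans nge).
have -> : r = 2 * rho by rewrite /rho mulrC divfK.
rewrite powRM ?(ltW rho0) // => H.
have p0 a : 0 < rho `^ a by rewrite powR_gt0.
have rhoe : rho `^ e <= 2 `^ (- t) / K0.+1%:R by apply: d2P => //; lra.
have K1 : 0 < K0.+1%:R :> R by [].
rewrite -(ler_pM2r (p0 (- (m + 2 * e)))) -(ler_pM2r K1).
apply: le_trans (_ : 2 `^ (- t) * rho `^ (- t) <= _); last by rewrite mulrAC.
rewrite -powRD ?(gt_eqF rho0) ?implybT //.
have -> : - (t - m - 3 * e) + - (m + 2 * e) = e + - t by ring.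
rewrite powRD ?(gt_eqF rho0) ?implybT // mulrAC ler_pM2r //.
by rewrite -ler_pdivlMr.
Unshelve. all: by end_near. Qed.

End Projections.

(** * From small scales to the upper box dimension *)

Lemma upper_box_dim_lt_ratio (R : realType) (d : nat) (E : set 'rV[R]_d) (c : R) :
  (upper_box_dim E < c%:E)%E ->
  exists n : nat, forall r, 0 < r -> r < n.+1%:R^-1 -> (box_ratio E r < c%:E)%E.
Proof.
move=> /ereal_inf_lt [_ [V V0 <-] Vc].
have [dl /= dl0 dlV] := V0.
(* Thresholds of the form [1 / (n + 1)] keep the later union over thresholds countable. *)
exists (Num.truncn dl^-1) => r r0 rlt; apply: le_lt_trans Vc.
apply: ereal_sup_ubound; exists r => //; apply: dlV => //=.
rewrite sub0r normrN gtr0_norm //; apply: lt_le_trans rlt _.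
rewrite -[leRHS]invrK lef_pV2 ?posrE ?invr_gt0 //.
exact/ltW/truncnS_gt.
Qed.

Lemma negligible_small_upper_box_dim (R : realType) (d k : nat)
  (gamma : probability (BorelMx R d) R) (X : set 'rV[R]_d)
  (theta a1 a2 C1 C2 m t e : R) :
  @rotation_invariant_grass_measure R d k gamma -> (k <= d)%N ->
  ebounded X -> X !=set0 -> 0 < theta -> theta < 1 ->
  0 < C1 -> spectrum_bound theta X a1 C1 -> 0 < C2 -> assouad_bound X a2 C2 ->
  0 <= m -> a1 - k%:R <= m -> (a2 - k%:R) * (1 - theta) <= m ->
  (t%:E < upper_box_dim X)%E -> 0 < e ->
  gamma.-negligible [set P : BorelMx R d |
    (upper_box_dim (projV (P : 'M[R]_d) X) < (t - m - 3 * e)%:E)%E].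
Proof.
move=> Hg kd Xb X0 th0 th1 C10 spec C20 ass m0 a1m a2m tX e0.
have C0 : 0 < C1 + C2 by rewrite addr_gt0.
have spec' : spectrum_bound theta X a1 (C1 + C2).
  move=> r Rr x h1 h2 h3 h4 h5; apply: le_trans (spec _ _ _ h1 h2 h3 h4 h5) _.
  by rewrite lee_fin ler_wpM2r ?powR_ge0 // lerDl ltW.
have ass' : assouad_bound X a2 (C1 + C2).
  move=> r Rr x h1 h2 h3; apply: le_trans (ass _ _ _ h1 h2 h3) _.
  by rewrite lee_fin ler_wpM2r ?powR_ge0 // lerDr ltW.
apply: negligibleS (negligible_bigcup (F := fun n =>
  [set P : BorelMx R d | forall r, 0 < r -> r < n.+1%:R^-1 ->
    (box_ratio (projV (P : 'M[R]_d) X) r < (t - m - 3 * e)%:E)%E]) _).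
  by move=> P /= /upper_box_dim_lt_ratio [n nP]; exists n.
move=> n; apply: (negligible_small_box_ratios Hg kd Xb X0 th0 th1 C0 spec' ass') => //.
Qed.

(** Reduces the final inequality, also when [s] is [+oo], to countably many inequalities between [y]
    and reals, each of which may fail on its own null set. *)
Lemma ereal_real_approx (R : realType) (s : \bar R) (m : R) : s != -oo%E ->
  exists t : nat -> R, (forall i, (t i)%:E < s)%E /\
    forall y : \bar R, (forall i, (t i - m - i.+1%:R^-1)%:E <= y)%E -> (s - m%:E <= y)%E.
Proof.
have inv_le e : 0 < e -> exists i, i.+1%:R^-1 <= e :> R.
  move=> e0; exists (Num.truncn e^-1).
  rewrite -[leRHS]invrK lef_pV2 ?posrE ?invr_gt0 //; exact/ltW/truncnS_gt.
case: s => [s| |//] _.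
- exists (fun i => s - i.+1%:R^-1); split => [i|y H].
    by rewrite lte_fin ltrBlDr ltrDl invr_gt0.
  apply/lee_addgt0Pr => e e0.
  have [i ie] := inv_le _ (divr_gt0 e0 (ltr0n R 2)).
  apply: (@le_trans _ _ ((s - i.+1%:R^-1 - m - i.+1%:R^-1)%:E + e%:E)%E).
    rewrite -EFinB -EFinD lee_fin; move: (i.+1%:R^-1) ie => q; lra.
  exact: leeD2r.
- exists (fun i => i%:R); split => [i|y H]; first by rewrite ltry.
  case: y H => [y| |] H; rewrite ?leey //; exfalso.
    have := H (Num.truncn (`|y| + `|m| + 1)).+1.
    rewrite lee_fin.
    have := truncnS_gt (`|y| + `|m| + 1).
    have : (Num.truncn (`|y| + `|m| + 1)).+2%:R^-1 <= 1 :> R.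
      by rewrite invf_le1 // ler1n.
    move: (Num.truncn _) => N; move: (N.+2%:R^-1) (N.+1%:R : R) => q T.
    have := ler_norm y; have := ler_norm m; lra.
  by have := H 0%N.
Qed.

Theorem theorem4p1 (R : realType) (d k : nat) (theta : R)
  (gamma : probability (BorelMx R d) R)
  (Hk : (1 <= k)%N /\ (k < d)%N)
  (Htheta : 0 < theta /\ theta < 1)
  (Hgamma : @rotation_invariant_grass_measure R d k gamma)
  (X : set 'rV[R]_d) (HX0 : X !=set0) (HXb : ebounded X) :
  {ae gamma, forall P : BorelMx R d, @grass R d k P ->
    (upper_box_dim (projV P X) >=
     upper_box_dim X
     - maxe 0 (maxe (upper_assouad_spectrum theta X - (k%:R)%:E)
                    ((assouad_dim X - (k%:R)%:E) * (1 - theta)%:E)))%E}.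
Proof.
have [th0 th1] := Htheta; have [_ /ltnW kd] := Hk.
have th1' : 0 < 1 - theta by rewrite subr_gt0.
have [->|XNy] := eqVneq (upper_box_dim X) -oo%E.
  by apply: aeW => P _; rewrite addNye leNye.
(* If the spectrum or the Assouad dimension is [+oo], so is the maximum, and subtracting it gives
   [-oo] even from [+oo]. Neither can be [-oo], being an infimum of positive numbers. *)
case specE : (upper_assouad_spectrum theta X) => [a| |]; last 2 first.
- apply: aeW => P _; rewrite addye // maxye maxey /=.
  by case: (upper_box_dim X) => [s| |]; rewrite leNye.
- suff : (0 <= upper_assouad_spectrum theta X)%E by rewrite specE leeNy_eq.
  by apply: le_ereal_inf_tmp => _ [b [b0 _] <-]; rewrite lee_fin ltW.
case assE : (assouad_dim X) => [A| |]; last 2 first.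
- apply: aeW => P _; rewrite addye // mulyr gtr0_sg // mul1e maxey maxey /=.
  by case: (upper_box_dim X) => [s| |]; rewrite leNye.
- suff : (0 <= assouad_dim X)%E by rewrite assE leeNy_eq.
  by apply: le_ereal_inf_tmp => _ [b [b0 _] <-]; rewrite lee_fin ltW.
rewrite -!EFinB -EFinM -!EFin_max.
set m := Num.max _ _.
have [m0 am Am] : [/\ 0 <= m, a - k%:R <= m & (A - k%:R) * (1 - theta) <= m].
  by rewrite /m !le_max !lexx ?orbT.
have [t [tX tP]] := ereal_real_approx m XNy.
have neg i : gamma.-negligible [set P : BorelMx R d |
    (upper_box_dim (projV (P : 'M[R]_d) X) < (t i - m - i.+1%:R^-1)%:E)%E].
  (* The infima need not be attained: one [e] covers the excess of the exponents [a1] and [a2], and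
     three are lost in the negligibility lemma, for a total of [1 / (i + 1)]. *)
  pose e : R := i.+1%:R^-1 / 4.
  have e0 : 0 < e by rewrite divr_gt0 // invr_gt0.
  have [_ [a1 [a10 [C1 [C10 spec]]] <-]] : exists2 y : \bar R,
    [set a%:E | a in [set a : R | 0 < a /\ exists C : R, 0 < C /\ spectrum_bound theta X a C]] y &
      (y < (a + e)%:E)%E.
    by apply: ereal_inf_lt; rewrite [X in (X < _)%E]specE lte_fin ltrDl.
  rewrite lte_fin => a1e.
  have [_ [a2 [a20 [C2 [C20 ass]]] <-]] : exists2 y : \bar R,
    [set a%:E | a in [set a : R | 0 < a /\ exists C : R, 0 < C /\ assouad_bound X a C]] y &
      (y < (A + e)%:E)%E.
    by apply: ereal_inf_lt; rewrite [X in (X < _)%E]assE lte_fin ltrDl.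
  rewrite lte_fin => a2e.
  have -> : t i - m - i.+1%:R^-1 = t i - (m + e) - 3 * e by rewrite /e; field.
  apply: (negligible_small_upper_box_dim Hgamma kd HXb HX0 th0 th1 C10 spec C20 ass) => //.
  - by lra.
  - by lra.
  - apply: (@le_trans _ _ ((A + e - k%:R) * (1 - theta))).
      by rewrite ler_pM2r //; lra.
    have : e * (1 - theta) <= e by rewrite ger_pMr //; lra.
    by lra.
apply: negligibleS (negligible_bigcup neg) => P /= nP.
apply: contrapT => H; apply: nP => _; apply: tP => i.
by rewrite leNgt; apply/negP => Hi; apply: H; exists i.
Qed.
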